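(* Let $G$ be a finite simple graph on $n$ vertices with at least one edge, and let $R=\mathbb{K}[V(G)]$ for a field $\mathbb{K}$. Then $$\mathrm{v}(I(G))+\deg\big(h_{R/I(G)}(t)\big)\le n.$$ Moreover, equality holds if and only if $G$ is a disjoint union of star graphs $K_{1,m_1},\ldots,K_{1,m_k}$ with all $m_j\ge1$ (in particular $G$ has no isolated vertices).
   Context: $I(G)=(x_ix_j\mid\{x_i,x_j\}\in E(G))$ is the edge ideal. The v-number of a proper graded ideal $I\subseteq R$ is $\mathrm{v}(I)=\min\{d\ge0\mid\exists f\in R_d,\ \mathfrak p\in\mathrm{Ass}(I),\ I:(f)=\mathfrak p\}$. The Hilbert series of $R/I$ is written uniquely as $h_{R/I}(t)/(1-t)^{\dim(R/I)}$ with $h_{R/I}(t)\in\mathbb{Z}[t]$, $h_{R/I}(1)\ne0$; $h_{R/I}(t)$ is the $h$-polynomial. The star graph $K_{1,m}$ has vertices $x_0,x_1,\ldots,x_m$ and edges $\{x_0,x_i\}$, $1\le i\le m$. *)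

(* Defs.v *)
From HB Require Import structures.
From mathcomp Require Import all_boot all_order all_algebra.
From mathcomp Require Import mpoly.
Set Implicit Arguments. Unset Strict Implicit. Unset Printing Implicit Defensive.
Import Order.TTheory GRing.Theory.
Local Open Scope ring_scope.

Section EdgeIdeals.
Variables (K : fieldType) (n : nat).
Local Notation R := {mpoly K[n]}.

Definition ideal (I : R -> Prop) : Prop :=
  [/\ I 0, (forall p q, I p -> I q -> I (p + q)) & (forall r p, I p -> I (r * p))].

Definition prime_ideal (P : R -> Prop) : Prop :=
  [/\ ideal P, ~ P 1 & (forall a b, P (a * b) -> P a \/ P b)].

(* f is homogeneous of degree d (f \in R_d); 0 is in every R_d *)
Definition is_homog (d : nat) (f : R) : Prop :=
  forall m, m \in msupp f -> mdeg m = d.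

Definition colon (I : R -> Prop) (f : R) : R -> Prop := fun g => I (g * f).

Definition same_set (A B : R -> Prop) : Prop := forall x, A x <-> B x.

Definition Ass (I : R -> Prop) (P : R -> Prop) : Prop :=
  prime_ideal P /\ exists g : R, same_set (colon I g) P.

Definition vnum_witness (I : R -> Prop) (d : nat) : Prop :=
  exists f : R, exists P : R -> Prop, is_homog d f /\ Ass I P /\ same_set (colon I f) P.

Definition is_vnumber (I : R -> Prop) (v : nat) : Prop :=
  vnum_witness I v /\ forall d, vnum_witness I d -> (v <= d)%N.

Definition edge_ideal (E : rel 'I_n) : R -> Prop := fun p =>
  exists q : 'I_n -> 'I_n -> R,
    p = \sum_(i < n) \sum_(j < n) (if E i j then q i j * 'X_i * 'X_j else 0).

Definition indep_mod (I : R -> Prop) (k : nat) (f : 'I_k -> R) : Prop :=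
  forall c : 'I_k -> K, I (\sum_(i < k) c i *: f i) -> forall i, c i = 0.

Definition hilb_fun (I : R -> Prop) (d m : nat) : Prop :=
  (exists f : 'I_m -> R, (forall i, is_homog d (f i)) /\ indep_mod I f) /\
  (forall (k : nat) (f : 'I_k -> R), (forall i, is_homog d (f i)) -> indep_mod I f -> (k <= m)%N).

(* HS_{R/I}(t) = h(t) / (1-t)^D with h(1) <> 0, i.e. HS(t) (1-t)^D = h(t)
   as formal power series *)
Definition hilb_rep (I : R -> Prop) (h : {poly int}) (D : nat) : Prop :=
  exists F : nat -> nat, (forall d, hilb_fun I d (F d)) /\ h.[1] != 0 /\
    forall k : nat, h`_k = \sum_(i < D.+1 | (i <= k)%N)
                             (-1) ^+ i * ('C(D, i))%:Z * (F (k - i)%N)%:Z.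

End EdgeIdeals.

Definition is_star {n : nat} (E : rel 'I_n) (B : {set 'I_n}) : Prop :=
  exists2 c, c \in B &
    (2 <= #|B|)%N /\
    forall x y, x \in B -> y \in B ->
      (E x y <-> ((x == c) && (y != c)) || ((y == c) && (x != c))).

Definition star_forest {n : nat} (E : rel 'I_n) : Prop :=
  exists P : {set {set 'I_n}},
    partition P [set: 'I_n] /\
    (forall B, B \in P -> is_star E B) /\
    (forall x y, E x y -> exists2 B, B \in P & (x \in B) && (y \in B)).

(* Main.v *)
(* Let alpha be the independence number of G. Summing t^|S| / (1-t)^|S| over the independent
   sets S, the Hilbert series has h-polynomial sum_S t^|S| (1-t)^(alpha-|S|), of degree at
   most alpha, with equality iff sum_S (-1)^|S| <> 0. The v-number is the least |A| with A
   independent and V \ N(A) independent. For a maximum independent set S, one neighbour in S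
   for each vertex outside S gives such an A with |A| <= n - alpha, hence the bound.

   In the case of equality there is no isolated vertex (toggling it would make the alternating
   sum vanish) and every A has at least n - alpha elements, which forces each vertex of S to
   be a leaf and V \ S to be independent. Conversely, for a star forest, toggling a leaf of a
   star whose centre is not in S cancels all terms of the alternating sum except that of the
   set of centres, and A must meet every star. *)
Require Import Defs.
From HB Require Import structures.
From mathcomp Require Import all_boot all_order all_algebra.
From mathcomp Require Import mpoly.
Set Implicit Arguments. Unset Strict Implicit. Unset Printing Implicit Defensive.
Import Order.TTheory GRing.Theory Num.Theory.
Local Open Scope ring_scope.

(** * Independent sets *)

Section Graphs.
Variables (T : finType) (E : rel T).
Implicit Types (x y : T) (A S : {set T}).

Definition independent S := [forall x in S, forall y in S, ~~ E x y].

Definition nbhd A := [set y | [exists x in A, E x y]].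

(* For such [A], [I : x_A] is the prime generated by the variables in [nbhd A]. *)
Definition v_set A := independent A && independent (~: nbhd A).

(* [r] sends each vertex to the centre of its star. *)
Definition star_map (r : T -> T) :=
  [/\ forall x, r (r x) = r x,
      forall x y, E x y = (x != y) && ((r x == y) || (r y == x))
    & forall x, exists y, E x y].

Lemma independentP S :
  reflect (forall x y, x \in S -> y \in S -> ~~ E x y) (independent S).
Proof.
apply: (iffP forall_inP) => [h x y xS yS|h x xS].
  by move/forall_inP: (h x xS); apply.
by apply/forall_inP => y yS; apply: h.
Qed.

Lemma independentPn S :
  reflect (exists x y, [/\ x \in S, y \in S & E x y]) (~~ independent S).
Proof.
rewrite negb_forall_in; apply: (iffP exists_inP) => [[x xS]|[x [y [xS yS e]]]].
  by rewrite negb_forall_in => /exists_inP[y yS /negbNE e]; exists x, y.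
by exists x => //; rewrite negb_forall_in; apply/exists_inP; exists y; rewrite ?negbK.
Qed.

Lemma independentS S S' : S \subset S' -> independent S' -> independent S.
Proof.
by move=> /subsetP sSS' /independentP h; apply/independentP => x y /sSS' ? /sSS'; apply: h.
Qed.

Lemma independent0 : independent set0.
Proof. by apply/independentP => x y; rewrite inE. Qed.

Lemma nbhdP A y : reflect (exists2 x, x \in A & E x y) (y \in nbhd A).
Proof. by rewrite inE; apply: exists_inP. Qed.

Definition indep_number := \max_(S | independent S) #|S|.

Lemma independent_le S : independent S -> (#|S| <= indep_number)%N.
Proof. by move=> iS; apply: (@leq_bigmax_cond _ independent (fun S : {set T} => #|S|)). Qed.

Lemma max_independent : exists2 S, independent S & #|S| = indep_number.
Proof.
rewrite /indep_number.
have [|S iS ->] := @eq_bigmax_cond _ independent (fun S : {set T} => #|S|).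
  by apply/card_gt0P; exists set0; apply: independent0.
by exists S.
Qed.

(** * Toggling a vertex, and alternating sums over independent sets *)

Definition toggle x S := if x \in S then S :\ x else x |: S.

Lemma toggleK x : involutive (toggle x).
Proof.
move=> S; rewrite /toggle; case: (boolP (x \in S)) => xS.
  by rewrite setD11 setD1K.
by rewrite setU11 setU1K.
Qed.

Lemma in_toggle x S y : y != x -> (y \in toggle x S) = (y \in S).
Proof. by move=> nyx; rewrite /toggle; case: ifP => _; rewrite !inE ?nyx // (negbTE nyx). Qed.

Lemma toggle_sign x S : (-1) ^+ #|toggle x S| = - (-1) ^+ #|S| :> int.
Proof.
rewrite /toggle; case: (boolP (x \in S)) => xS.
  by rewrite (cardsD1 x S) xS exprS mulN1r opprK.
by rewrite cardsU1 xS exprS mulN1r.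
Qed.

(** A sign-reversing involution: since the chosen vertex survives its own toggle, the sets in [P]
    pair off with opposite signs. *)
Lemma sum_toggle0 (P : pred {set T}) (l : {set T} -> T) :
    (forall S, P S -> P (toggle (l S) S)) ->
    (forall S, P S -> l (toggle (l S) S) = l S) ->
  \sum_(S | P S) (-1) ^+ #|S| = 0 :> int.
Proof.
(* Extended by the identity outside [P], the toggle is an involution on all sets, so the whole sum
   can be reindexed. *)
move=> PP ll; pose f S := if P S then toggle (l S) S else S.
have fK : involutive f.
  move=> S; rewrite /f; case: (boolP (P S)) => PS; last by rewrite (negbTE PS).
  by rewrite PP // ll // toggleK.
have Pf S : P (f S) = P S.
  by rewrite /f; case: (boolP (P S)) => PS; [rewrite PP | apply: negbTE].
set s := \sum_(_ | _) _.
have s_opp : s = - s.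
  rewrite {1}/s (reindex_inj (inv_inj fK)) /= /s -sumrN.
  apply: eq_big => [S|S]; rewrite Pf // => PS.
  by rewrite /f PS toggle_sign.
by apply/eqP; move/eqP: s_opp; rewrite -subr_eq0 opprK -mulr2n mulrn_eq0.
Qed.

Hypotheses (irrE : ssrbool.irreflexive E) (symE : ssrbool.symmetric E).

Lemma sum_independent_isolated x : (forall y, ~~ E x y) ->
  \sum_(S | independent S) (-1) ^+ #|S| = 0 :> int.
Proof.
move=> iso; apply: (@sum_toggle0 _ (fun _ => x)) => // S /independentP iS.
apply/independentP => y z; have [->|nyx] := eqVneq y x; first by rewrite iso.
have [->|nzx] := eqVneq z x; first by rewrite symE iso.
by rewrite !in_toggle //; apply: iS.
Qed.

(** An independent set other than [C] misses some centre, because an independent set containing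
    every centre contains no leaf. A leaf of a missing centre has no other neighbour, so toggling it
    preserves independence. *)
Lemma sum_independent_stars r (x0 : T) : star_map r ->
  \sum_(S | independent S) (-1) ^+ #|S| != 0 :> int.
Proof.
case=> rr Er noiso; pose C := [set x | r x == x].
have iC : independent C.
  apply/independentP => x y; rewrite !inE Er => /eqP-> /eqP->.
  by rewrite [y == x]eq_sym orbb andNb.
pose nb x := odflt x [pick y | E x y].
have Enb x : E x (nb x).
  rewrite /nb; case: pickP => // h; have [y] := noiso x.
  by rewrite h.
have nbC c : c \in C -> nb c \notin C.
  by move=> cC; apply: contraL (Enb c); move/independentP: iC; apply.
have nbE c y : c \in C -> E (nb c) y -> y = c.
  move=> cC; have := Enb c; rewrite !Er => /andP[nc].
  move: (cC) (nbC _ cC); rewrite !inE => /eqP->; rewrite eq_sym (negbTE nc) => nrc /=.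
  move=> /eqP rc; rewrite rc; case/andP=> ny /orP[/eqP//|/eqP ry].
  by move: nrc; rewrite -ry rr eqxx.
(* The choice depends on [S] only through [C :\: S], which toggling a leaf leaves unchanged. The
   default [x0] is never reached for an independent [S] other than [C]. *)
pose l S := if [pick c in C :\: S] is Some c then nb c else x0.
have lP S : independent S && (S != C) -> exists2 c, (c \in C) && (c \notin S) & l S = nb c.
  move=> /andP[iS nSC]; rewrite /l; case: pickP => [c|h].
    by rewrite inE andbC => cCS; exists c.
  have CS : C \subset S.
    apply/subsetP => c cC; apply: negbNE; apply/negP => cS.
    by have := h c; rewrite inE cS cC.
  case/negP: nSC; rewrite eqEsubset CS andbT; apply/subsetP => y yS.
  rewrite inE; apply: contraT => ny.
  move/independentP: iS => /(_ y (r y) yS); rewrite Er eqxx eq_sym ny; apply.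
  by apply: (subsetP CS); rewrite inE rr.
have inT c d S : c \in C -> d \in C -> (d \in toggle (nb c) S) = (d \in S).
  by move=> cC dC; rewrite in_toggle //; apply: contraTneq dC => ->; apply: nbC.
rewrite (bigD1 C) //= (@sum_toggle0 _ l) ?addr0 ?signr_eq0 // => S PS.
  have [c /andP[cC cS] ->] := lP S PS; case/andP: PS => iS _.
  apply/andP; split; last by apply: contraNneq cS => tC; rewrite -(inT c) // tC.
  have nbT y : y \in toggle (nb c) S -> ~~ E (nb c) y.
    by move=> yt; apply: contraNN cS => /(nbE _ _ cC) yc; move: yt; rewrite yc inT.
  apply/independentP => y z yt zt.
  have [yE|yn] := eqVneq y (nb c); first by rewrite yE nbT.
  have [zE|zn] := eqVneq z (nb c); first by rewrite symE zE nbT.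
  by move: yt zt; rewrite !in_toggle //; move/independentP: iS; apply.
have [c /andP[cC cS] lS] := lP S PS; rewrite {1}lS /l.
have -> : C :\: toggle (nb c) S = C :\: S; last by [].
by apply/setP => y; rewrite !in_setD; case: (boolP (y \in C)) => yC; rewrite ?andbF ?inT.
Qed.

(** For an edge from a centre [c] to [y], independence of the complement of [nbhd E A] puts [c] or
    [y] in [nbhd E A]. The neighbour in [A] thus obtained lies in the same star, so [r] maps [A]
    onto the centres. *)
Lemma v_set_star_map r A : star_map r -> v_set A -> (#|[set x | r x == x]| <= #|A|)%N.
Proof.
case=> rr Er noiso /andP[iA /independentP iN]; apply: leq_trans (leq_imset_card r A).
apply: subset_leq_card; apply/subsetP => c; rewrite inE => /eqP rc.
have rE x y : E x y -> r x = r y by rewrite Er => /andP[_ /orP[/eqP<-|/eqP<-]]; rewrite rr.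
have [y Ecy] := noiso c.
have [z zN rz] : exists2 z, z \in nbhd A & r z = c.
  case: (boolP (c \in nbhd A)) => cN; first by exists c.
  exists y; last by rewrite -(rE _ _ Ecy).
  by apply: contraTT Ecy => yN; apply: iN; rewrite inE.
have /nbhdP[a aA Eaz] := zN.
by apply/imsetP; exists a => //; rewrite (rE _ _ Eaz).
Qed.

Lemma indep_number_star_map r : star_map r -> (#|T| <= indep_number + #|[set x | r x == x]|)%N.
Proof.
case=> rr Er noiso; rewrite -(cardsC [set x | r x == x]) addnC leq_add2r.
apply: independent_le; apply/independentP => x y; rewrite !inE => nx ny; rewrite Er.
rewrite negb_and; apply/orP; right; apply/norP; split.
  by apply: contraNneq ny => <-; rewrite rr.
by apply: contraNneq nx => <-; rewrite rr.
Qed.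

(** * Maximum independent sets and the extremal case *)

Section Equality.
Variable S : {set T}.
Hypotheses (iS : independent S) (cardS : #|S| = indep_number).

Lemma max_independent_nbr c : c \notin S -> exists2 b, b \in S & E c b.
Proof.
move=> cS; have: ~~ independent (c |: S).
  by apply: contraTN isT => /independent_le; rewrite cardsU1 cS cardS ltnn.
move/independentPn => [x [y [/setU1P[->|xS] /setU1P[->|yS]]]].
- by rewrite irrE.
- by exists y.
- by rewrite symE; exists x.
- by move/independentP: iS => /(_ x y xS yS) /negbTE->.
Qed.

(** The image lies in [S], and every vertex outside [S] is adjacent to it, so the vertices it does
    not dominate also lie in [S]. *)
Lemma v_set_imset (g : T -> T) : (forall c, c \notin S -> g c \in S /\ E c (g c)) ->
  v_set (g @: (~: S)).
Proof.
move=> gP; have sub : g @: (~: S) \subset S.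
  by apply/subsetP => _ /imsetP[c cS ->]; apply: (gP c _).1; rewrite inE in cS.
apply/andP; split; first exact: independentS iS.
apply: independentS iS; apply/subsetP => y; rewrite inE; apply: contraNT => yS.
apply/nbhdP; exists (g y); first by apply: imset_f; rewrite inE.
by rewrite symE; apply: (gP y yS).2.
Qed.

Definition max_nbr c := odflt c [pick b in S | E c b].

Lemma max_nbrP c : c \notin S -> max_nbr c \in S /\ E c (max_nbr c).
Proof.
move=> /max_independent_nbr[b bS Ecb]; rewrite /max_nbr.
by case: pickP => [d /andP[]//|/(_ b)]; rewrite bS Ecb.
Qed.

Lemma v_set_le_cocard : exists2 A, v_set A & (#|A| + indep_number <= #|T|)%N.
Proof.
exists (max_nbr @: (~: S)); first exact/v_set_imset/max_nbrP.
by rewrite -cardS -(cardsC S) addnC leq_add2l leq_imset_card.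
Qed.

Hypothesis noiso : forall x, exists y, E x y.
Hypothesis v_extremal : forall A, v_set A -> (#|T| <= #|A| + indep_number)%N.

Let v_ge A : v_set A -> (#|~: S| <= #|A|)%N.
Proof. by move/v_extremal; rewrite -cardS -(cardsC S) addnC leq_add2r. Qed.

(* If [b] had two neighbours, [b] and one further neighbour for each vertex outside
   [S] not adjacent to [b] would form a v-set that is too small. *)
Lemma extremal_leaf b c d : b \in S -> E b c -> E b d -> c = d.
Proof.
move=> bS Ebc Ebd; have nS x : E b x -> x \notin S.
  by move=> Ebx; apply: contraTN Ebx; move/independentP: iS; apply.
pose g x := if E b x then b else max_nbr x.
have gP x : x \notin S -> g x \in S /\ E x (g x).
  by move=> xS; rewrite /g; case: ifP => [Ebx|_]; [rewrite symE | apply: max_nbrP].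
have /v_ge := v_set_imset gP; rewrite leq_eqVlt ltnNge leq_imset_card orbF eq_sym.
move/imset_injP; apply; rewrite ?inE ?nS //.
by rewrite /g Ebc Ebd.
Qed.

(** Given an edge [c c'] outside [S], take [c] and one neighbour in [S] for each vertex of [D], the
    vertices outside [S] that [c] neither equals nor dominates. This is a v-set, and it is too small
    because [D] omits both [c] and [c']. *)
Lemma extremal_independentC : independent (~: S).
Proof.
apply: contraT => /independentPn[c [c' []]]; rewrite !inE => cS c'S Ecc'.
pose D := [set x in ~: S | (x != c) && ~~ E c x].
have DS x : x \in D -> x \notin S by rewrite !inE => /andP[].
(* By [extremal_leaf], [x] is the only neighbour of [max_nbr x]; hence [c] is not adjacent to the
   neighbours chosen for [D]. *)
have leaf x y : x \notin S -> E y (max_nbr x) -> y = x.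
  move=> xS Ey; have [mS Ex] := max_nbrP xS.
  by apply: (extremal_leaf mS); rewrite symE.
have iM : v_set (c |: max_nbr @: D).
  apply/andP; split.
    apply/independentP => x y /setU1P[->|/imsetP[x' xD ->]] /setU1P[->|/imsetP[y' yD ->]].
    + by rewrite irrE.
    + by apply/negP => /(leaf _ _ (DS _ yD)) cE; move: yD; rewrite -cE !inE eqxx andbF.
    + by rewrite symE; apply/negP => /(leaf _ _ (DS _ xD)) cE; move: xD; rewrite -cE !inE eqxx andbF.
    + by move/independentP: iS; apply; [exact: (max_nbrP (DS _ xD)).1 | exact: (max_nbrP (DS _ yD)).1].
  (* Outside [S] only [c] itself can be undominated, and no neighbour of [c] is undominated, so an
     undominated edge would lie inside [S]. *)
  have out x : x \notin S -> x \in ~: nbhd (c |: max_nbr @: D) -> x = c.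
    move=> xS; rewrite inE => /nbhdP xN; apply/eqP/negPn/negP => xc; apply: xN.
    case: (boolP (E c x)) => Ecx; first by exists c; rewrite ?setU11.
    exists (max_nbr x); last by rewrite symE; apply: (max_nbrP xS).2.
    by apply/setU1P; right; apply: imset_f; rewrite !inE xS xc.
  apply/independentP => x y xN yN; apply/negP => Exy.
  have nEc z : z \in ~: nbhd (c |: max_nbr @: D) -> ~~ E c z.
    by rewrite inE; apply: contraNN => Ecz; apply/nbhdP; exists c; rewrite ?setU11.
  case: (boolP (x \in S)) => xS; last first.
    by have := nEc y yN; rewrite -(out x xS xN) Exy.
  case: (boolP (y \in S)) => yS; last first.
    by have := nEc x xN; rewrite -(out y yS yN) symE Exy.
  by move/independentP: iS => /(_ x y xS yS); rewrite Exy.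
have := v_ge iM; rewrite leqNgt => /negP[].
have cc' : c != c' by apply: contraTneq Ecc' => ->; rewrite irrE.
have DC : D \subset (~: S) :\ c :\ c'.
  apply/subsetP => x; rewrite !inE => /and3P[-> -> nEcx]; rewrite !andbT.
  by apply: contraNneq nEcx => ->.
rewrite (cardsD1 c (~: S)) (cardsD1 c' (_ :\ c)) !inE cS c'S eq_sym cc' /=.
rewrite !add1n ltnS (leq_trans (leq_card_setU _ _)) // cards1 add1n ltnS.
by apply: leq_trans (leq_imset_card _ _) (subset_leq_card DC).
Qed.

(** The vertices outside [S] serve as centres, and each vertex of [S] is a leaf sent to its unique
    neighbour. *)
Lemma extremal_star_map : exists r, star_map r.
Proof.
pose nb x := odflt x [pick y | E x y].
have Enb x : E x (nb x).
  by rewrite /nb; case: pickP => // h; have [y] := noiso x; rewrite h.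
have nbS b : b \in S -> nb b \notin S.
  by move=> bS; apply: contraL (Enb b); move/independentP: iS; apply.
exists (fun x => if x \in S then nb x else x); split=> [x|x y|//].
  by case: (boolP (x \in S)) => xS; rewrite ?(negbTE (nbS x xS)) ?(negbTE xS).
have [->|xy] /= := eqVneq x y; first by rewrite irrE.
have Eb b z : b \in S -> E b z = (nb b == z).
  by move=> bS; apply/idP/eqP => [|<- //]; apply: extremal_leaf.
case: (boolP (x \in S)) => xS; case: (boolP (y \in S)) => yS.
- rewrite (Eb _ _ xS); move/independentP: iS => /(_ x y xS yS).
  rewrite (Eb _ _ xS) => /negbTE->; apply/esym/negbTE.
  by move/independentP: iS => /(_ y x yS xS); rewrite Eb.
- by rewrite (Eb _ _ xS) [y == x]eq_sym (negbTE xy) orbF.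
- by rewrite symE (Eb _ _ yS) (negbTE xy).
- rewrite [y == x]eq_sym (negbTE xy) /=; apply: negbTE.
  by move/independentP: extremal_independentC; apply; rewrite inE.
Qed.
End Equality.
End Graphs.

(** One direction sends a vertex to a centre of its block; the other takes the fibres of [r] as
    blocks. *)
Lemma star_forest_map n (E : rel 'I_n) :
    ssrbool.irreflexive E -> ssrbool.symmetric E ->
  star_forest E <-> exists r, star_map E r.
Proof.
move=> irrE symE; split=> [[P [partP [starP blockP]]]|[r [rr Er noiso]]].
  have [/eqP covP trivP P0] := and3P partP.
  have xcov x : x \in cover P by rewrite covP inE.
  (* In a two-vertex block both vertices qualify as centre. Picking from the block alone makes the
     choice common to all its vertices. *)
  pose star (B : {set 'I_n}) (c : 'I_n) := [forall x in B, forall y in B,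
    E x y == ((x == c) && (y != c) || (y == c) && (x != c))].
  have pickB B : B \in P -> {c | [pick c in B | star B c] = Some c & (c \in B) && star B c}.
    move=> BP; case: pickP => [c cP|h]; first by exists c.
    exfalso; have [c cB [_ sB]] := starP B BP.
    have /negP := h c; rewrite cB; apply.
    apply/forall_inP => x xB; apply/forall_inP => y yB; apply/eqP.
    by apply/idP/idP => /sB; apply.
  pose r x := odflt x [pick c in pblock P x | star (pblock P x) c].
  have rP x : (r x \in pblock P x) && star (pblock P x) (r x).
    by rewrite /r; have [c ->] := pickB _ (pblock_mem (xcov x)).
  have rE x y : pblock P x = pblock P y -> r x = r y.
    by move=> xy; rewrite /r xy; have [c ->] := pickB _ (pblock_mem (xcov y)).
  have pr x : pblock P (r x) = pblock P x.
    by apply: same_pblock => //; case/andP: (rP x).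
  have Er x y : pblock P x = pblock P y ->
      E x y = (x == r x) && (y != r x) || (y == r x) && (x != r x).
    move=> xy; have /andP[_ /forall_inP/(_ x)] := rP x.
    rewrite mem_pblock xcov => /(_ isT)/forall_inP/(_ y).
    by rewrite xy mem_pblock xcov => /(_ isT)/eqP.
  exists r; split=> [x|x y|x]; first exact/rE/pr.
    have [xy|nxy] := eqVneq (pblock P x) (pblock P y).
      rewrite Er // -(rE _ _ xy) [r x == y]eq_sym [r x == x]eq_sym.
      have [<-|xr] /= := eqVneq x (r x); first by rewrite orbT andbT andbF orbF eq_sym.
      by have [->|] /= := eqVneq y (r x); rewrite ?xr ?andbF.
    have -> : E x y = false.
      apply: contraNF nxy => /blockP[B BP /andP[xB yB]].
      by rewrite (def_pblock trivP BP xB) (def_pblock trivP BP yB).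
    apply/esym/negbTE; rewrite negb_and; apply/orP; right; apply/norP.
    by split; apply: contraNneq nxy => <-; rewrite pr.
  (* A centre gets its neighbour from the requirement that a block have at least two vertices. *)
  have [nx|xr] := eqVneq x (r x); last first.
    by exists (r x); rewrite Er ?pr // eqxx /= xr orbT.
  have [c _ [/card_gt1P[y [z [yB zB yz]]] _]] := starP _ (pblock_mem (xcov x)).
  have [w wB wx] : exists2 w, w \in pblock P x & w != x.
    by have [yx|] := eqVneq y x; [exists z => //; rewrite -yx eq_sym | exists y].
  exists w; rewrite Er; last by apply/esym/same_pblock.
  by rewrite -nx eqxx wx.
exists (preim_partition r setT); have pP := preim_partitionP r [set: 'I_n].
have blockE x : [set y in setT | r x == r y] \in preim_partition r setT.
  by apply: imset_f.
split=> //; split=> [_ /imsetP[x _ ->]|x y]; last first.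
  rewrite Er => /andP[_ xy]; exists [set z in setT | r x == r z] => //.
  by rewrite !inE eqxx; case/orP: xy => /eqP<-; rewrite rr !eqxx.
exists (r x); first by rewrite !inE rr eqxx.
have rz z : E (r x) z -> r z = r x.
  by rewrite Er rr => /andP[nz /orP[/eqP|/eqP]] // zx; move: nz; rewrite zx eqxx.
split=> [|y z].
  have [z Ez] := noiso (r x); apply/card_gt1P; exists (r x), z; split; rewrite ?inE ?rr ?eqxx //.
    by rewrite (rz _ Ez) eqxx.
  by apply: contraTneq Ez => <-; rewrite irrE.
rewrite !inE => /eqP yB /eqP zB; rewrite Er -yB -zB [r x == z]eq_sym [r x == y]eq_sym.
suff -> : (y != z) && ((z == r x) || (y == r x))
  = (y == r x) && (z != r x) || (z == r x) && (y != r x) by [].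
have [->|yr] /= := eqVneq y (r x); first by rewrite orbT andbT andbF orbF eq_sym.
by have [->|] /= := eqVneq z (r x); rewrite ?yr ?andbF.
Qed.

(** * The v-number *)

Section EdgeIdeal.
Variables (K : fieldType) (n : nat) (E : rel 'I_n).
Hypotheses (irrE : ssrbool.irreflexive E) (symE : ssrbool.symmetric E).
Implicit Types (p q f : {mpoly K[n]}) (m : 'X_{1..n}) (A : {set 'I_n}).

Local Notation I := (@edge_ideal K n E).

Definition msupport m : {set 'I_n} := [set i | (0 < m i)%N].

Lemma msupportD m m' : msupport (m + m')%MM = msupport m :|: msupport m'.
Proof. by apply/setP => i; rewrite !inE mnmDE addn_gt0. Qed.

Lemma edge_ideal_sum (J : Type) (s : seq J) (P : pred J) (F : J -> {mpoly K[n]}) :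
  (forall j, P j -> I (F j)) -> I (\sum_(j <- s | P j) F j).
Proof.
move=> IF; apply: big_ind => //.
  exists (fun _ _ => 0); rewrite big1 // => i _; rewrite big1 // => j _.
  by rewrite !mul0r if_same.
move=> p q [f ->] [g ->]; exists (fun i j => f i j + g i j).
rewrite -big_split; apply: eq_bigr => i _; rewrite -big_split; apply: eq_bigr => j _ /=.
by case: ifP; rewrite ?addr0 // !mulrDl.
Qed.

Lemma edge_ideal_edge p i j : E i j -> I (p * 'X_i * 'X_j).
Proof.
move=> Eij; exists (fun k l => if (k == i) && (l == j) then p else 0).
rewrite (bigD1 i) //= (bigD1 j) //= Eij !eqxx /= !big1 ?addr0 // => [k ki|l lj].
  by rewrite big1 // => l _; rewrite (negbTE ki) /= !mul0r if_same.
by rewrite (negbTE lj) !mul0r if_same.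
Qed.

Lemma mcoeff_mulX_eq0 p i m : m i = 0%N -> (p * 'X_i)@_m = 0.
Proof.
move=> mi; apply: memN_msupp_eq0; rewrite (perm_mem (msuppMX _ _)).
by apply/mapP => -[m' _ mE]; move: mi; rewrite mE mnmDE mnm1E eqxx.
Qed.

(** The edge ideal is a monomial ideal: membership is tested monomial by monomial, and a monomial
    belongs exactly when its support contains an edge. *)
Lemma edge_idealP p :
  I p <-> forall m, independent E (msupport m) -> p@_m = 0.
Proof.
split=> [[q ->] m /independentP im|p0].
  rewrite raddf_sum big1 // => i _; rewrite raddf_sum big1 // => j _ /=.
  case: ifP => [Eij|]; last by rewrite mcoeff0.
  have [mi|mi] := posnP (m i); last have [mj|mj] := posnP (m j).
  - by rewrite mulrAC mcoeff_mulX_eq0.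
  - by rewrite mcoeff_mulX_eq0.
  - by move: (im i j); rewrite !inE Eij => /(_ mi mj).
rewrite [p]mpolyE big_seq; apply: edge_ideal_sum => m.
rewrite mcoeff_msupp => pm; have /independentPn[i [j [mi mj Eij]]] : ~~ independent E (msupport m).
  by apply: contraNN pm => /p0 ->.
rewrite !inE in mi mj.
have ij : i != j by apply: contraTneq Eij => ->; rewrite irrE.
have -> : 'X_[m] = 'X_[K, m - U_(i) - U_(j)] * 'X_i * 'X_j.
  rewrite -!mpolyXD; congr 'X_[_]; apply/mnmP => k; rewrite !mnmDE !mnmBE !mnm1E.
  have [<-|ik] := eqVneq i k; first by rewrite eq_sym (negbTE ij) !subn0 addn0 subnK.
  by have [<-|jk] := eqVneq j k; rewrite ?subn0 ?addn0 // subnK.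
by rewrite !scalerAl; apply: edge_ideal_edge.
Qed.

(** The kernel is the prime generated by the variables in [A]. Presenting it as the kernel of a ring
    morphism into a domain makes primality immediate. *)
Definition face_proj A : {mpoly K[n]} -> {mpoly K[n]} :=
  mmap (@mpolyC n K) (fun i => if i \in A then 0 else 'X_i).

Lemma face_proj_eq0 A p :
  face_proj A p = 0 <-> forall m, [disjoint msupport m & A] -> p@_m = 0.
Proof.
have projX m : mmap1 (fun i => if i \in A then 0 else 'X_i) m =
    if [disjoint msupport m & A] then 'X_[K, m] else 0.
  case: ifPn => [/disjointFr dm|/pred0Pn[i /andP[/= mi iA]]].
    rewrite mpolyXE_id; apply: eq_bigr => i _; case: (posnP (m i)) => [->|mi].
      by rewrite !expr0.
    by rewrite dm // inE.
  by rewrite /mmap1 (bigD1 i) //= iA expr0n eqn0Ngt; move: mi; rewrite inE => -> /=; rewrite mul0r.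
have projE : face_proj A p =
    \sum_(m <- msupp p) if [disjoint msupport m & A] then p@_m *: 'X_[m] else 0.
  rewrite /face_proj /mmap; apply: eq_bigr => m _.
  by rewrite projX mul_mpolyC; case: ifP => // _; rewrite scaler0.
split=> [p0 m dm|p0]; last first.
  by rewrite projE big1 // => m _; case: ifP => // /p0->; rewrite scale0r.
have [mp|] := boolP (m \in msupp p); last exact: memN_msupp_eq0.
have := congr1 (mcoeff m) p0; rewrite mcoeff0 projE raddf_sum /=.
rewrite (bigD1_seq m) ?msupp_uniq //= dm mcoeffZ mcoeffX eqxx mulr1 big1 ?addr0 // => m' m'm.
by case: ifP; rewrite ?mcoeff0 // mcoeffZ mcoeffX (negbTE m'm) mulr0.
Qed.

Lemma face_proj_prime A : prime_ideal (fun p => face_proj A p = 0).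
Proof.
split=> [||a b].
- split=> [|p q p0 q0|r p p0]; first exact: rmorph0.
    by rewrite /face_proj rmorphD /= -!/(face_proj _ _) p0 q0 addr0.
  by rewrite /face_proj rmorphM /= -!/(face_proj _ _) p0 mulr0.
- by rewrite /face_proj rmorph1 => /eqP; rewrite oner_eq0.
rewrite /face_proj rmorphM /= => /eqP; rewrite mulf_eq0.
by case/orP => /eqP; [left | right].
Qed.

Definition set_mnm A : 'X_{1..n} := [multinom (i \in A : nat) | i < n].

Lemma msupport_set_mnm A : msupport (set_mnm A) = A.
Proof. by apply/setP => i; rewrite inE mnmE lt0b. Qed.

Lemma mdeg_set_mnm A : mdeg (set_mnm A) = #|A|.
Proof. by rewrite mdegE -sum1_card [RHS]big_mkcond; apply: eq_bigr => i _; rewrite mnmE; case: (i \in A). Qed.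

(** In the support of [m] joined with [A], an edge inside [A] is impossible, and one inside
    [msupport m] is impossible once [m] avoids [nbhd E A]. What remains is an edge between the two,
    that is, a variable of [m] in [nbhd E A]. *)
Lemma same_set_colon_monomial A : v_set E A ->
  same_set (colon I 'X_[set_mnm A]) (fun p => face_proj (nbhd E A) p = 0).
Proof.
move=> /andP[/independentP iA /independentP iN] p.
have disjE m : [disjoint msupport m & nbhd E A]
             = independent E (msupport (m + set_mnm A)%MM).
  rewrite msupportD msupport_set_mnm; apply/idP/independentP => [dm x y|h].
    have dN x' y' : x' \in A -> y' \in msupport m -> ~~ E x' y'.
      by move=> xA ym; have := disjointFr dm ym; apply: contraFN => Exy; apply/nbhdP; exists x'.
    rewrite !inE; case/orP=> [xm|xA] /orP[ym|yA].
    - apply: iN; rewrite inE.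
        by rewrite (disjointFr dm) // inE.
      by rewrite (disjointFr dm) // inE.
    - by rewrite symE dN // inE.
    - by rewrite dN // inE.
    - exact: iA.
  apply/pred0Pn => -[y /andP[/= ym /nbhdP[x xA Exy]]].
  by have := h x y; rewrite Exy in_setU xA orbT in_setU ym => /(_ isT isT).
rewrite /colon edge_idealP face_proj_eq0; split=> p0 m.
  by rewrite disjE => /p0; rewrite addmC mcoeffMX.
case: (boolP (m \in msupp (p * 'X_[set_mnm A]))) => [|/memN_msupp_eq0 //].
rewrite (perm_mem (msuppMX _ _)) => /mapP[m' _ ->].
by rewrite addmC -disjE => /p0; rewrite addmC mcoeffMX.
Qed.

Lemma v_set_witness A : v_set E A -> vnum_witness I #|A|.
Proof.
move=> vA; exists 'X_[set_mnm A], (fun p => face_proj (nbhd E A) p = 0).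
have colA := same_set_colon_monomial vA.
split=> [m|]; first by rewrite msuppX mem_seq1 => /eqP->; rewrite mdeg_set_mnm.
by split=> //; split; [exact: face_proj_prime | exists 'X_[set_mnm A]].
Qed.

(* Any monomial of [f] outside [I] works: each edge [x y] has an endpoint, say [x], in
   the prime [I : f], so that ['X_x] times the monomial lies in [I]. *)
Lemma witness_v_set d : vnum_witness I d -> exists2 A, v_set E A & (#|A| <= d)%N.
Proof.
case=> f [P [fd [[[[P0 _ PM] P1 Pprime] _] colP]]].
have colE p : P p <-> I (p * f) by split=> [/colP|/colP].
have [m im fm] : exists2 m, independent E (msupport m) & f@_m != 0.
  case: (boolP (has (fun m => independent E (msupport m)) (msupp f))) => [/hasP[m mf im]|/hasPn h].
    by exists m => //; rewrite -mcoeff_msupp.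
  (* If every monomial of [f] had dependent support, [f] would be in the ideal and the colon would
     contain 1. *)
  case: P1; apply/colE; rewrite mul1r; apply/edge_idealP => m im.
  by apply: memN_msupp_eq0; apply: contraL im => /h.
exists (msupport m); last first.
  rewrite -(fd m) ?mcoeff_msupp // mdegE -sum1_card [leqLHS]big_mkcond.
  by apply: leq_sum => i _; rewrite inE; case: posnP.
(* The coefficient of [f * 'X_x] at [m + U_(x)] is nonzero, so that support contains an edge. As
   [msupport m] is independent, the edge ends at [x]. *)
have PN x : P 'X_x -> x \in nbhd E (msupport m).
  move=> /colE; rewrite mulrC => /edge_idealP/(_ (m + U_(x))%MM); rewrite {2}addmC mcoeffMX => h.
  have /independentPn[i [j [im' jm' Eij]]] : ~~ independent E (msupport (m + U_(x))).
    by apply: contraNN fm => /h ->.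
  have in1 k : k \in msupport (m + U_(x)) -> k = x \/ k \in msupport m.
    rewrite !inE mnmDE mnm1E; have [->|_] := eqVneq x k; first by left.
    by rewrite addn0; right.
  case: (in1 i im') => [ix|im1]; case: (in1 j jm') => [jx|jm1].
  - by move: Eij; rewrite ix jx irrE.
  - by apply/nbhdP; exists j; rewrite // symE -ix.
  - by apply/nbhdP; exists i; rewrite // -jx.
  - by move/independentP: im => /(_ i j im1 jm1); rewrite Eij.
apply/andP; split=> //; apply/independentP => x y; rewrite !in_setC => xN yN.
apply/negP => Exy; have : P ('X_x * 'X_y).
  by apply/colE; rewrite mulrC mulrA; apply: edge_ideal_edge.
by case/Pprime => /PN zN; [rewrite zN in xN | rewrite zN in yN].
Qed.

Lemma v_number_exists : exists v, is_vnumber I v.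
Proof.
have [S iS cS] := max_independent E; have [A0 vA0 _] := v_set_le_cocard irrE symE iS cS.
exists #|[arg min_(A < A0 | v_set E A) #|A|]|; case: arg_minnP => // A vA minA.
split=> [|d /witness_v_set[B vB]]; first exact: v_set_witness.
exact: leq_trans (minA B vB).
Qed.

End EdgeIdeal.

(** * The Hilbert series *)

Section Hilbert.
Variables (K : fieldType) (n : nat) (E : rel 'I_n).
Hypotheses (irrE : ssrbool.irreflexive E) (symE : ssrbool.symmetric E).

Local Notation I := (@edge_ideal K n E).
Local Notation alpha := (indep_number E).

Lemma hilb_fun_inj (J : {mpoly K[n]} -> Prop) d a b :
  hilb_fun J d a -> hilb_fun J d b -> a = b.
Proof.
move=> [[f [fd fi]] fmax] [[g [gd gi]] gmax]; apply/eqP; rewrite eqn_leq.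
by rewrite (gmax _ f fd fi) (fmax _ g gd gi).
Qed.

(** The degree [d] monomials with independent support form a basis of the degree [d] part of the
    quotient. *)
Lemma hilb_fun_monomials (s : seq 'X_{1..n}) d : uniq s ->
    (forall m, (m \in s) = (mdeg m == d) && independent E (msupport m)) ->
  hilb_fun I d (size s).
Proof.
move=> us sP; split.
  exists (fun i => 'X_[nth 0%MM s i]); split=> [i m|c Ic i].
    rewrite msuppX mem_seq1 => /eqP->.
    by have := mem_nth 0%MM (ltn_ord i); rewrite sP => /andP[/eqP].
  have := mem_nth 0%MM (ltn_ord i); rewrite sP => /andP[_].
  move/(edge_idealP irrE): Ic => /[apply].
  rewrite raddf_sum (bigD1 i) //= mcoeffZ mcoeffX eqxx mulr1 big1 ?addr0 // => j ji.
  by rewrite mcoeffZ mcoeffX nth_uniq // val_eqE (negbTE ji) mulr0.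
(* A nonzero vector in the left kernel of the coefficient matrix would be a linear relation modulo
   the ideal, so [k] is at most the number of columns. *)
move=> k f fd fi; pose M := \matrix_(i < k, j < size s) (f i)@_(nth 0%MM s j).
suff /eqP <- : row_free M by apply: rank_leq_col.
rewrite -kermx_eq0; apply: contraT => /rowV0Pn[u /sub_kermxP uM] /negP[].
apply/eqP/rowP => i; rewrite mxE; apply: (fi (fun i => u 0 i)).
apply/(edge_idealP irrE) => m im; rewrite raddf_sum /=.
have [md|md] := eqVneq (mdeg m) d; last first.
  rewrite big1 // => j _; rewrite mcoeffZ memN_msupp_eq0 ?mulr0 //.
  by apply: contraNN md => /fd ->.
have ms : m \in s by rewrite sP md eqxx im.
have lt_ms : (index m s < size s)%N by rewrite index_mem.
have /rowP/(_ (Ordinal lt_ms)) := uM; rewrite !mxE => {2}<-.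
by apply: eq_bigr => j _; rewrite mcoeffZ !mxE /= nth_index.
Qed.

Definition expo_support N (m : {ffun 'I_n -> 'I_N.+1}) := [set i | m i != ord0].

(** Capping exponents at [N] keeps the sum finite; up to degree [N] its coefficients are those of
    the Hilbert series. *)
Definition hilb_poly N : {poly int} :=
  \sum_(m : {ffun 'I_n -> 'I_N.+1} | independent E (expo_support m)) 'X^(\sum_i m i).

Definition std_monomials N d :=
  [set m : {ffun 'I_n -> 'I_N.+1} |
    ((\sum_i m i)%N == d) && independent E (expo_support m)].

Lemma coef_hilb_poly N d : (hilb_poly N)`_d = #|std_monomials N d|%:Z.
Proof.
rewrite /hilb_poly coef_sum -[RHS]natz -sum1_card natr_sum.
rewrite big_mkcond [RHS]big_mkcond; apply: eq_bigr => m _.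
by rewrite inE coefXn eq_sym; case: ifP; case: eqP.
Qed.

Lemma hilb_fun_std_monomials N d : (d <= N)%N -> hilb_fun I d #|std_monomials N d|.
Proof.
move=> dN; pose mk (m : {ffun 'I_n -> 'I_N.+1}) := [multinom (m i : nat) | i < n].
have mk_inj : injective mk.
  move=> a b /mnmP ab; apply/ffunP => i; apply/val_inj.
  by have := ab i; rewrite !mnmE.
have suppE m : msupport (mk m) = expo_support m.
  by apply/setP => i; rewrite !inE mnmE lt0n.
have degE m : mdeg (mk m) = (\sum_i m i)%N.
  by rewrite mdegE; apply: eq_bigr => i _; rewrite mnmE.
rewrite cardE -(size_map mk); apply: hilb_fun_monomials.
  by rewrite map_inj_uniq ?enum_uniq.
move=> m; apply/mapP/andP => [[m' + ->]|[/eqP md im]].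
  by rewrite mem_enum inE suppE degE => /andP.
have mN i : (m i < N.+1)%N.
  by rewrite ltnS (leq_trans _ dN) // -md mdegE (bigD1 i) //= leq_addr.
have mE : m = mk [ffun i => Ordinal (mN i)].
  by apply/mnmP => i; rewrite mnmE ffunE.
exists [ffun i => Ordinal (mN i)] => //.
by rewrite mem_enum inE -suppE -degE -mE md eqxx.
Qed.

(** * The h-polynomial over the common denominator, its uniqueness and its degree *)

Definition indep_h : {poly int} :=
  \sum_(S | independent E S) (1 - 'X) ^+ (alpha - #|S|) * 'X^#|S|.

Lemma mul_X_coef_small (p : {poly int}) N k : (k <= N)%N -> ('X^(N.+1) * p)`_k = 0.
Proof. by move=> kN; rewrite coefXnM ltnS kN. Qed.

Lemma coef_mul_eq (c a b : {poly int}) N :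
  (forall k, (k <= N)%N -> a`_k = b`_k) -> (c * a)`_N = (c * b)`_N.
Proof.
by move=> ab; rewrite !coefM; apply: eq_bigr => i _; rewrite ab ?leq_subr.
Qed.

(** Monomials are grouped by support: each vertex of [S] independently takes a nonzero exponent, and
    all others take 0. *)
Lemma hilb_poly_faces N : hilb_poly N =
  \sum_(S | independent E S) (\sum_(j < N.+1 | j != ord0) 'X^j) ^+ #|S|.
Proof.
rewrite /hilb_poly (partition_big (@expo_support N) (independent E)) //=.
apply: eq_bigr => S iS; rewrite -prodr_const [RHS]big_mkcond /=.
transitivity (\prod_(i < n) \sum_(j < N.+1 | (j != ord0) == (i \in S)) 'X^j : {poly int}).
  rewrite bigA_distr_big_dep; apply: eq_big => [m|m _]; last by rewrite prodrXr.
  apply/andP/familyP => [[_ /eqP<-] i|mS]; first by rewrite unfold_in /= inE.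
  have -> : expo_support m = S by apply/setP => i; rewrite inE; apply/eqP: (mS i).
  by rewrite eqxx.
apply: eq_bigr => i _; case: (i \in S); first by apply: eq_bigl => j; rewrite eqb_id.
by rewrite (bigD1 ord0) //= big1 ?addr0 ?expr0 // => j; case: (j == ord0).
Qed.

(** Each vertex of [S] absorbs one factor [1 - 'X], turning its truncated geometric sum into
    ['X - 'X^(N.+1)], which is ['X] up to degree [N]. *)
Lemma coef_hilb_poly_mul N k : (k <= N)%N ->
  ((1 - 'X) ^+ alpha * hilb_poly N)`_k = indep_h`_k.
Proof.
move=> kN; rewrite hilb_poly_faces mulr_sumr /indep_h !coef_sum.
apply: eq_bigr => S /independent_le Sa.
set g := \sum_(_ < _ | _) _.
have gE : (1 - 'X) * g = 'X - 'X^(N.+1).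
  have -> : g = 'X * \sum_(j < N) 'X^j.
    rewrite /g big_mkcond big_ord_recl eqxx /= add0r mulr_sumr.
    by apply: eq_bigr => j _; rewrite /= -exprS.
  by rewrite mulrCA -opprB mulNr -subrX1 opprB mulrBr mulr1 -exprS.
rewrite -(subnK Sa) exprD -mulrA -exprMn gE subnK //.
have -> : ('X - 'X^(N.+1)) ^+ #|S| = 'X^#|S| - 'X^(N.+1) * \sum_(i < #|S|)
    ('X - 'X^(N.+1)) ^+ (#|S|.-1 - i) * 'X^i :> {poly int}.
  apply/eqP; rewrite eq_sym subr_eq addrC -subr_eq -opprB subrXX.
  by rewrite addrAC subrr sub0r mulNr opprK.
by rewrite mulrBr coefB mulrCA mul_X_coef_small ?subr0.
Qed.

Lemma hilb_conv (a : {poly int}) D k :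
  ((1 - 'X) ^+ D * a)`_k =
  \sum_(i < D.+1 | (i <= k)%N) (-1) ^+ i * ('C(D, i))%:Z * a`_(k - i).
Proof.
rewrite exprBn mulr_suml coef_sum [RHS]big_mkcond; apply: eq_bigr => i _ /=.
have -> : (-1) ^+ i = ((-1) ^+ i)%:P :> {poly int} by rewrite rmorphXn rmorphN1.
rewrite expr1n mulr1 mulrnAl coefMn -(mulrA _%:P) coefCM coefXnM.
case: ltnP => _; first by rewrite mulr0 mul0rn.
by rewrite -mulrnAl -mulr_natr natz.
Qed.

(** The power series identity becomes a family of polynomial identities, one for each truncation
    [N], valid up to degree [N]. *)
Lemma hilb_rep_coef h D : hilb_rep I h D <->
  h.[1] != 0 /\ forall N k, (k <= N)%N -> h`_k = ((1 - 'X) ^+ D * hilb_poly N)`_k.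
Proof.
split=> [[F [FP [h1 hk]]]|[h1 hk]].
  split=> // N k kN; rewrite hk hilb_conv; apply: eq_bigr => i _; congr (_ * _).
  have kiN : (k - i <= N)%N by rewrite (leq_trans (leq_subr _ _)).
  by rewrite coef_hilb_poly (hilb_fun_inj (FP _) (hilb_fun_std_monomials kiN)).
exists (fun d => #|std_monomials d d|); split=> [d|]; first exact: hilb_fun_std_monomials.
split=> // k; rewrite (hk k k (leqnn k)) hilb_conv; apply: eq_bigr => i _; congr (_ * _).
rewrite coef_hilb_poly; congr (Posz _).
apply: hilb_fun_inj (hilb_fun_std_monomials _) (hilb_fun_std_monomials (leqnn _)).
exact: leq_subr.
Qed.

(** At 1 only the maximum independent sets contribute, each with value 1. *)
Lemma indep_h1 : indep_h.[1] != 0.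
Proof.
have [S0 iS0 cS0] := max_independent E.
have hE S : independent E S ->
    ((1 - 'X) ^+ (alpha - #|S|) * 'X^#|S|).[1] = (alpha <= #|S|)%N%:R :> int.
  by move=> iS; rewrite !(hornerM, horner_exp, hornerE) subrr expr1n mulr1 expr0n subn_eq0.
rewrite /indep_h horner_sum (eq_bigr _ hE) (bigD1 S0) //= cS0 leqnn.
by rewrite lt0r_neq0 // ltr_pwDl ?ltr01 // sumr_ge0 // => S _; rewrite ler0n.
Qed.

Lemma hilb_rep_indep_h : hilb_rep I indep_h alpha.
Proof.
apply/hilb_rep_coef; split=> [|N k kN]; first exact: indep_h1.
by rewrite coef_hilb_poly_mul.
Qed.

(** Cross-multiplying two representations gives one polynomial identity; unequal exponents would
    leave a factor [1 - 'X] in a numerator that does not vanish at 1. *)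
Lemma hilb_rep_uniq h D : hilb_rep I h D -> h = indep_h.
Proof.
move=> /hilb_rep_coef[h1 hk].
have eq_mul : (1 - 'X) ^+ alpha * h = (1 - 'X) ^+ D * indep_h.
  apply/polyP => k; rewrite (coef_mul_eq _ (hk k)) mulrCA.
  by apply: coef_mul_eq => j; apply: coef_hilb_poly_mul.
have X1 : (1 - 'X : {poly int}) != 0.
  by rewrite -opprB oppr_eq0 -polyC1 polyXsubC_eq0.
have cancel a b (p q : {poly int}) : (a < b)%N -> p.[1] != 0 ->
    (1 - 'X) ^+ a * p = (1 - 'X) ^+ b * q -> False.
  move=> ab p1; rewrite -(subnKC (ltnW ab)) exprD -mulrA => /mulfI.
  rewrite expf_neq0 // => /(_ isT) pE; case/eqP: p1.
  by rewrite pE hornerM horner_exp !hornerE subrr expr0n subn_eq0 leqNgt ab mul0r.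
case: (ltngtP alpha D) => [aD|Da|aD].
- by case: (cancel _ _ _ _ aD h1 eq_mul).
- by case: (cancel _ _ _ _ Da indep_h1 (esym eq_mul)).
by move: eq_mul; rewrite aD => /mulfI; apply; apply: expf_neq0.
Qed.

Let size_1subX : size (1 - 'X : {poly int}) = 2%N.
Proof. by rewrite -opprB size_polyN -polyC1 size_XsubC. Qed.

Lemma size_indep_h : (size indep_h <= alpha.+1)%N.
Proof.
apply: (leq_trans (size_sum _ _ _)); apply/bigmax_leqP => S /independent_le Sa.
apply: (leq_trans (size_polyMleq _ _)); rewrite size_polyXn addnS /=.
rewrite -[in leqRHS](subnK Sa) -addSn leq_add2r (leq_trans (size_poly_exp_leq _ _)) //.
by rewrite size_1subX mul1n.
Qed.

Lemma coef_indep_h_top :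
  indep_h`_alpha = (-1) ^+ alpha * \sum_(S | independent E S) (-1) ^+ #|S|.
Proof.
rewrite mulr_sumr coef_sum; apply: eq_bigr => S /independent_le Sa.
rewrite coefMXn ltnNge Sa /=.
have top d : ((1 - 'X : {poly int}) ^+ d)`_d = (-1) ^+ d.
  have -> : -1 = lead_coef (1 - 'X : {poly int}).
    by rewrite lead_coefE size_1subX coefB coef1 coefX.
  by rewrite -lead_coef_exp lead_coefE size_exp size_1subX mul1n.
by rewrite top -[in RHS](subnK Sa) exprD -mulrA -expr2 sqrr_sign mulr1.
Qed.

Lemma deg_indep_h :
  (((size indep_h).-1 == alpha) = (\sum_(S | independent E S) (-1) ^+ #|S| != 0 :> int)).
Proof.
have -> : (\sum_(S | independent E S) (-1) ^+ #|S| != 0 :> int) = (indep_h`_alpha != 0).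
  by rewrite coef_indep_h_top mulf_eq0 signr_eq0.
apply/eqP/idP => [<-|top].
  (* The predecessor of [size] is 0 for the zero polynomial too; [indep_h1] excludes that case. *)
  by rewrite -lead_coefE lead_coef_eq0; apply: contraNneq indep_h1 => ->; rewrite horner0.
suff -> : size indep_h = alpha.+1 by [].
apply/eqP; rewrite eqn_leq size_indep_h ltnNge.
by apply: contraNN top => /(nth_default 0)->.
Qed.

End Hilbert.

(** * The inequality and the characterization of equality *)

Theorem theorem4p2 (K : fieldType) (n : nat) (E : rel 'I_n) :
  ssrbool.irreflexive E -> ssrbool.symmetric E -> (exists i j, E i j) ->
  (exists v, is_vnumber (@edge_ideal K n E) v) /\
  (exists h D, hilb_rep (@edge_ideal K n E) h D) /\
  (forall (v : nat) (h : {poly int}) (D : nat),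
     is_vnumber (@edge_ideal K n E) v -> hilb_rep (@edge_ideal K n E) h D ->
     (v + (size h).-1 <= n)%N /\ ((v + (size h).-1)%N = n <-> star_forest E)).
Proof.
move=> irrE symE [x0 _]; split; first exact: v_number_exists.
split; first by exists (indep_h E), (indep_number E); apply: hilb_rep_indep_h.
move=> v h D [wit_v min_v] /(hilb_rep_uniq irrE) {h D} ->.
have v_le A : v_set E A -> (v <= #|A|)%N by move/(v_set_witness K irrE symE)/min_v.
have deg_le : ((size (indep_h E)).-1 <= indep_number E)%N.
  by rewrite -subn1 leq_subLR size_indep_h.
have [S iS cS] := max_independent E.
have v_add : (v + indep_number E <= n)%N.
  have [A /v_le vA] := v_set_le_cocard irrE symE iS cS.
  by rewrite card_ord; apply: leq_trans; rewrite leq_add2r.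
have le_n : (v + (size (indep_h E)).-1 <= n)%N.
  by apply: leq_trans v_add; rewrite leq_add2l.
split=> //; rewrite star_forest_map //; split=> [eq_n|[r star_r]].
  (* Since [v + indep_number E] is already at most [n], equality forces the degree to reach
     [indep_number E]. *)
  have deg_eq : (size (indep_h E)).-1 == indep_number E.
    by rewrite eqn_leq deg_le -(leq_add2l v) eq_n.
  apply: (extremal_star_map irrE symE iS cS) => [x|A /v_le vA].
    apply/existsP; apply: contraTT deg_eq => /existsPn iso.
    by rewrite deg_indep_h negbK (sum_independent_isolated symE iso).
  by rewrite card_ord -{1}eq_n (eqP deg_eq) leq_add2r.
have [A vA Av] := witness_v_set irrE symE wit_v.
have /eqP deg_eq : (size (indep_h E)).-1 == indep_number E.
  by rewrite deg_indep_h; apply: sum_independent_stars star_r.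
(* The reverse bound: [n] is at most [indep_number E] plus the number of centres, which is at most
   [#|A|] and so at most [v]. *)
apply/eqP; rewrite eqn_leq le_n /= deg_eq -[leqLHS](card_ord n).
apply: leq_trans (indep_number_star_map star_r) _.
by rewrite addnC leq_add2r (leq_trans (v_set_star_map star_r vA)).
Qed.
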